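(* Let $M$ be a matroid with ground set $\mathcal{A}$ and rank function $\mathrm{rk}$, let $k$ be a positive integer, and let $a\in\mathcal{A}$ be an element that is neither a loop nor a coloop of $M$. Then $$T^k_M((x_i)_1^k;(y_i)_1^k)=\sum_{j=0}^k sT^{k,j}_{M,a}((x_i)_1^k;(y_i)_1^k),$$ where $sT^{k,0}_{M,a}=T^k_{M/a}((x_i)_1^k;(y_i)_1^k)$, $sT^{k,k}_{M,a}=T^k_{M\backslash a}((x_i)_1^k;(y_i)_1^k)$, and for $j\in\{1,\dots,k-1\}$ $$sT^{k,j}_{M,a}=\sum_{\substack{S_1\subseteq S_2\subseteq\cdots\subseteq S_{k-j}\subseteq \mathcal{A}-a}} T^j_{M|_{S_1}}((x_i)_1^j;(y_i)_1^j)\prod_{i=1}^{k-j}(x_{i+j}-1)^{\mathrm{rk}(M/a)-\mathrm{rk}_{M/a}(S_i)}(y_{i+j}-1)^{|S_i|-\mathrm{rk}_{M/a}(S_i)}\prod_{i=1}^{j}(x_i-1)^{\mathrm{rk}(M)-\mathrm{rk}(S_1)}.$$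
   Context: For a matroid $N$ with ground set $E$ and rank function $\mathrm{rk}_N$, and a positive integer $k$, the $k$-th chain Tutte polynomial is $$T^k_N((x_i)_1^k;(y_i)_1^k)=\sum_{S_1\subseteq S_2\subseteq\cdots\subseteq S_k\subseteq E}\ \prod_{i=1}^k (x_i-1)^{\mathrm{rk}_N(E)-\mathrm{rk}_N(S_i)}(y_i-1)^{|S_i|-\mathrm{rk}_N(S_i)},$$ the sum running over all weakly increasing chains of $k$ subsets of $E$ (repetitions allowed). $\mathrm{rk}(N)=\mathrm{rk}_N(E)$. $M\backslash a$ is the deletion (ground set $\mathcal{A}-a$, rank function the restriction of $\mathrm{rk}$), $M/a$ the contraction (ground set $\mathcal{A}-a$, $\mathrm{rk}_{M/a}(X)=\mathrm{rk}(X\cup a)-\mathrm{rk}(a)$), and $M|_{S}$ the restriction of $M$ to $S$ (ground set $S$, rank function $\mathrm{rk}$ restricted to subsets of $S$). A loop is an element of rank $0$; a coloop is an element $a$ with $\mathrm{rk}(\mathcal{A}-a)=\mathrm{rk}(M)-1$. *)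

(* Defs.v *)
From mathcomp Require Import all_boot all_order all_algebra.

Set Implicit Arguments.
Unset Strict Implicit.
Unset Printing Implicit Defensive.

Import GRing.Theory.

(* The ground set is a subset of an ambient finite type, so that all minors of
   a matroid live over the same type. The values of [mrank] on sets that are
   not contained in [ground] are unconstrained and never used. *)
Record matroid (T : finType) := Matroid {
  ground : {set T};
  mrank : {set T} -> nat;
  mrank_le_card : forall A : {set T}, A \subset ground -> mrank A <= #|A|;
  mrank_mono : forall A B : {set T},
    A \subset B -> B \subset ground -> mrank A <= mrank B;
  mrank_submod : forall A B : {set T},
    A \subset ground -> B \subset ground ->
    mrank (A :|: B) + mrank (A :&: B) <= mrank A + mrank B
}.

Definition rk_matroid (T : finType) (M : matroid T) : nat :=
  mrank M (ground M).

Definition loop (T : finType) (M : matroid T) (a : T) : bool :=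
  (a \in ground M) && (mrank M [set a] == 0).

(* rk(E - a) = rk(M) - 1, stated without truncated subtraction. *)
Definition coloop (T : finType) (M : matroid T) (a : T) : bool :=
  (a \in ground M) && ((mrank M (ground M :\ a)).+1 == rk_matroid M).

Section Restriction.
Variables (T : finType) (M : matroid T) (S : {set T}).

Let E := ground M :&: S.

Fact restriction_le_card (A : {set T}) : A \subset E -> mrank M A <= #|A|.
Proof. by rewrite subsetI => /andP[AM _]; apply: mrank_le_card. Qed.

Fact restriction_mono (A B : {set T}) :
  A \subset B -> B \subset E -> mrank M A <= mrank M B.
Proof. by move=> AB; rewrite subsetI => /andP[BM _]; apply: mrank_mono. Qed.

Fact restriction_submod (A B : {set T}) :
  A \subset E -> B \subset E ->
  mrank M (A :|: B) + mrank M (A :&: B) <= mrank M A + mrank M B.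
Proof.
by rewrite !subsetI => /andP[AM _] /andP[BM _]; apply: mrank_submod.
Qed.

(* For S contained in the ground set this is M|_S, with ground set S; the
   intersection only makes the operation total. *)
Definition restriction : matroid T :=
  Matroid restriction_le_card restriction_mono restriction_submod.

End Restriction.

Section Deletion.
Variables (T : finType) (M : matroid T) (a : T).

Let E := ground M :\ a.

Let subE (A : {set T}) : A \subset E -> A \subset ground M.
Proof. by move=> AE; apply: subset_trans AE (subD1set _ _). Qed.

Fact deletion_le_card (A : {set T}) : A \subset E -> mrank M A <= #|A|.
Proof. by move=> /subE; apply: mrank_le_card. Qed.

Fact deletion_mono (A B : {set T}) :
  A \subset B -> B \subset E -> mrank M A <= mrank M B.
Proof. by move=> AB /subE; apply: mrank_mono. Qed.

Fact deletion_submod (A B : {set T}) :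
  A \subset E -> B \subset E ->
  mrank M (A :|: B) + mrank M (A :&: B) <= mrank M A + mrank M B.
Proof. by move=> /subE AM /subE BM; apply: mrank_submod. Qed.

Definition deletion : matroid T :=
  Matroid deletion_le_card deletion_mono deletion_submod.

End Deletion.

Section Contraction.
Variables (T : finType) (M : matroid T) (a : T).
Hypothesis aM : a \in ground M.

Let E := ground M :\ a.

Definition contraction_rank (X : {set T}) : nat :=
  mrank M (a |: X) - mrank M [set a].

Let subE (A : {set T}) : A \subset E -> a |: A \subset ground M.
Proof.
by move=> AE; rewrite subUset sub1set aM (subset_trans AE (subD1set _ _)).
Qed.

Let rank_a (A : {set T}) : A \subset E -> mrank M [set a] <= mrank M (a |: A).
Proof. by move=> AE; apply: mrank_mono (subE AE); apply: subsetUl. Qed.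

Fact contraction_le_card (A : {set T}) :
  A \subset E -> contraction_rank A <= #|A|.
Proof.
move=> AE; have AM : A \subset ground M := subset_trans AE (subD1set _ _).
rewrite leq_subLR; have aM1 : [set a] \subset ground M by rewrite sub1set.
apply: leq_trans (leq_addr (mrank M ([set a] :&: A)) _) _.
apply: leq_trans (mrank_submod aM1 AM) _.
by rewrite leq_add2l mrank_le_card.
Qed.

Fact contraction_mono (A B : {set T}) :
  A \subset B -> B \subset E -> contraction_rank A <= contraction_rank B.
Proof.
by move=> AB BE; apply/leq_sub2r/mrank_mono; [exact: setUS | exact: subE].
Qed.

Fact contraction_submod (A B : {set T}) :
  A \subset E -> B \subset E ->
  contraction_rank (A :|: B) + contraction_rank (A :&: B)
    <= contraction_rank A + contraction_rank B.
Proof.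
move=> AE BE.
have UE : A :|: B \subset E by rewrite subUset AE.
have IE : A :&: B \subset E by apply: subset_trans AE; apply: subsetIl.
rewrite -(leq_add2r (mrank M [set a] + mrank M [set a])) !(addnACA _ _ (mrank _ _)).
rewrite /contraction_rank !subnK ?rank_a //.
by rewrite setUUr setUIr mrank_submod ?subE.
Qed.

Definition contraction : matroid T :=
  Matroid contraction_le_card contraction_mono contraction_submod.

End Contraction.

Local Open Scope ring_scope.

Definition chain (T : finType) (n : nat) (E : {set T})
    (S : n.-tuple {set T}) : bool :=
  sorted (fun A B : {set T} => A \subset B) S
    && all (fun A : {set T} => A \subset E) S.

(* The variables x_1, ..., x_k and y_1, ..., y_k are numbered from 0 and taken
   in an arbitrary commutative ring (for instance the indeterminates of a
   polynomial ring over the integers); [x i] and [y i] matter only for i < k,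
   so that the same families serve for every k. *)
Definition chain_tutte (R : comNzRingType) (T : finType) (k : nat)
    (N : matroid T) (x y : nat -> R) : R :=
  \sum_(S : k.-tuple {set T} | chain (ground N) S)
    \prod_(i < k)
      ((x i - 1) ^+ (rk_matroid N - mrank N (tnth S i)) *
       (y i - 1) ^+ (#|tnth S i| - mrank N (tnth S i))).

(* In the last case the chains have length k - j > 0, so [head set0 S] is the
   smallest set of the chain. *)
Definition chain_tutte_split (R : comNzRingType) (T : finType) (k j : nat)
    (M : matroid T) (a : T) (aM : a \in ground M) (x y : nat -> R) : R :=
  let Ma := contraction aM in
  if j == 0%N then chain_tutte k Ma x y
  else if j == k then chain_tutte k (deletion M a) x y
  else
    \sum_(S : (k - j).-tuple {set T} | chain (ground M :\ a) S)
      chain_tutte j (restriction M (head set0 S)) x y *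
      (\prod_(i < k - j)
        ((x (i + j)%N - 1) ^+ (rk_matroid Ma - mrank Ma (tnth S i)) *
         (y (i + j)%N - 1) ^+ (#|tnth S i| - mrank Ma (tnth S i)))) *
      \prod_(i < j) (x i - 1) ^+ (rk_matroid M - mrank M (head set0 S)).

(* Main.v *)
Require Import Defs.
From mathcomp Require Import all_boot all_order all_algebra.

(** Along a chain [S_1 <= ... <= S_k] the sets avoiding [a] form an initial
    segment, of length [j] say; the [j]-th summand collects these chains. The
    last [k - j] sets are [a |: S'_i] with [S'_1 <= ... <= S'_(k-j)] in [E - a],
    and the first [j] sets form an arbitrary chain in [S'_1]. Since [a] is not a
    loop, ranks and cardinals relative to [M] and [M/a] differ by one on the last
    sets; since [a] is not a coloop, [M] and [M\a] have the same rank. *)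

Set Implicit Arguments.
Unset Strict Implicit.
Unset Printing Implicit Defensive.

Import GRing.Theory.

Local Open Scope ring_scope.

Section ChainSums.
Variables (R : comNzRingType) (T : finType).
Implicit Types (A E : {set T}) (w : nat -> {set T} -> R).

(** Inclusion is transitive, so sets below [A] are automatically inside [E]: once the largest set is
    removed, it serves as the ground set of the rest. *)
Lemma chain_rcons n E A (S : n.-tuple {set T}) :
  chain E (rcons_tuple S A) = (A \subset E) && chain A S.
Proof.
have tr : transitive (fun A B : {set T} => A \subset B).
  by move=> X Y Z; apply: subset_trans.
rewrite /chain /= !sorted_pairwise // pairwise_rcons all_rcons.
have [AE|] := boolP (A \subset E); last by rewrite andbF.
have [SA|] := boolP (all _ S); last by rewrite /= andbF.
rewrite /= andbT; apply/andb_idr => _; apply: sub_all SA => X XA.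
exact: subset_trans XA AE.
Qed.

Lemma big_chain_rcons n E (F : n.+1.-tuple {set T} -> R) :
  \sum_(S : n.+1.-tuple {set T} | chain E S) F S =
  \sum_(A : {set T} | A \subset E)
    \sum_(S : n.-tuple {set T} | chain A S) F (rcons_tuple S A).
Proof.
pose h (p : {set T} * n.-tuple {set T}) : n.+1.-tuple {set T} :=
  rcons_tuple p.2 p.1.
have h_inj : injective h.
  case=> A S [B U] /(congr1 val) /= /rcons_inj[/val_inj -> ->] //.
have h_bij : bijective h.
  by apply: inj_card_bij => //; rewrite card_prod !card_tuple expnS.
rewrite pair_big_dep (reindex h) /=; last exact: onW_bij.
by apply: eq_bigl => -[A S]; rewrite chain_rcons.
Qed.

Lemma big_chain0 E (F : 0.-tuple {set T} -> R) :
  \sum_(S : 0.-tuple {set T} | chain E S) F S = F [tuple].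
Proof.
by rewrite (big_pred1 [tuple]) // => S; rewrite (tuple0 S); apply/esym/eqP.
Qed.

Lemma prod_tnth_rcons n A (S : n.-tuple {set T}) w :
  \prod_(i < n.+1) w i (tnth (rcons_tuple S A) i) =
  (\prod_(i < n) w i (tnth S i)) * w n A.
Proof.
rewrite big_ord_recr /=; congr (_ * w _ _).
  apply: eq_bigr => i _; congr w.
  by rewrite !(tnth_nth set0) /= nth_rcons size_tuple ltn_ord.
by rewrite (tnth_nth set0) /= nth_rcons size_tuple ltnn eqxx.
Qed.

(** The weights are arbitrary so that splitting chains at [a] stays apart from all rank
    computations; [tutte_weight] below gives the chain Tutte polynomial. *)
Definition chain_sum n E w : R :=
  \sum_(S : n.-tuple {set T} | chain E S) \prod_(i < n) w i (tnth S i).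

Lemma chain_sum0 E w : chain_sum 0 E w = 1.
Proof. by rewrite /chain_sum big_chain0 big_ord0. Qed.

Lemma chain_sumS n E w :
  chain_sum n.+1 E w = \sum_(A : {set T} | A \subset E) chain_sum n A w * w n A.
Proof.
rewrite /chain_sum big_chain_rcons; apply: eq_bigr => A _.
by rewrite big_distrl; apply: eq_bigr => S _; rewrite prod_tnth_rcons.
Qed.

(* The chains of length [j + m] in [a |: E] whose first [j] sets avoid [a] and
   whose last [m] sets contain it. For [m = 0] the default value [E] of [head]
   makes this the sum over all chains of length [j] in [E]. *)
Definition split_chain_sum (a : T) m j E w : R :=
  \sum_(S : m.-tuple {set T} | chain E S)
    chain_sum j (head E S) w * \prod_(i < m) w (i + j)%N (a |: tnth S i).

Lemma split_chain_sum0 a j E w : split_chain_sum a 0 j E w = chain_sum j E w.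
Proof. by rewrite /split_chain_sum big_chain0 big_ord0 mulr1. Qed.

Lemma split_chain_sumS a m j E w :
  split_chain_sum a m.+1 j E w =
  \sum_(A : {set T} | A \subset E)
    split_chain_sum a m j A w * w (m + j)%N (a |: A).
Proof.
rewrite /split_chain_sum big_chain_rcons; apply: eq_bigr => A _.
rewrite big_distrl; apply: eq_bigr => S _ /=.
rewrite (prod_tnth_rcons A S (fun i B => w (i + j)%N (a |: B))) mulrA.
(* The smallest set of [rcons S A] is [head A S], so the default value passes from [E] to the new
   ground set [A], even for empty [S]. *)
by rewrite headI.
Qed.

Lemma big_subset_setU1 a E (F : {set T} -> R) : a \notin E ->
  \sum_(A : {set T} | A \subset a |: E) F A =
  \sum_(A : {set T} | A \subset E) F (a |: A) +
  \sum_(A : {set T} | A \subset E) F A.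
Proof.
move=> aE; rewrite (bigID (fun A : {set T} => a \in A)) /=; congr (_ + _).
  rewrite (reindex_onto (fun A => a |: A) (fun A => A :\ a)) /=; last first.
    by move=> A /andP[_ aA]; rewrite setD1K.
  apply: eq_bigl => A; rewrite setU11 andbT.
  apply/andP/idP => [[AE /eqP <-]|AE]; first by rewrite subDset.
  split; first exact: setUS.
  by rewrite setU1K //; apply: contra aE; apply/subsetP.
apply: eq_bigl => A; apply/andP/idP => [[AE aA]|AE].
  have <- : A :\ a = A by apply/setDidPl; rewrite disjoint_sym disjoints1.
  by rewrite subDset.
split; first by apply: subset_trans AE (subsetU1 _ _).
by apply: contra aE; apply/subsetP.
Qed.

(** Induction on the length, for all [E], by the largest set. If it avoids [a], so does the whole
    chain, which gives the summand of maximal [j]; otherwise it is [a |: A] and the induction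
    hypothesis applies to the rest, inside [a |: A]. *)
Lemma chain_sum_setU1 a n E w : a \notin E ->
  chain_sum n (a |: E) w = \sum_(j < n.+1) split_chain_sum a (n - j) j E w.
Proof.
elim: n E => [|n IHn] E aE.
  by rewrite big_ord1 split_chain_sum0 !chain_sum0.
rewrite chain_sumS big_subset_setU1 // big_ord_recr /= subnn split_chain_sum0.
rewrite chain_sumS; congr (_ + _).
(* For [j <= n] at least one set contains [a]; the last one has position [(n - j) + j = n], whatever
   [j] is. *)
under [RHS]eq_bigr => j _ do
  rewrite subSn -1?ltnS // split_chain_sumS subnK -1?ltnS //.
rewrite exchange_big; apply: eq_bigr => A AE.
by rewrite IHn ?big_distrl //; apply: contra aE; apply/subsetP.
Qed.

End ChainSums.

Section Tutte.
Variables (R : comNzRingType) (T : finType) (x y : nat -> R).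
Implicit Types (M : matroid T) (A : {set T}).

Definition tutte_weight M (i : nat) A : R :=
  (x i - 1) ^+ (rk_matroid M - mrank M A) * (y i - 1) ^+ (#|A| - mrank M A).

(** Each exponent [rk(M) - rk(S_i)] splits as [(rk(M) - rk(A)) + (rk(A) - rk(S_i))], and the first
    part does not depend on the chain. *)
Lemma chain_sum_subset k M A : A \subset ground M ->
  chain_sum k A (tutte_weight M) =
  chain_tutte k (restriction M A) x y *
  \prod_(i < k) (x i - 1) ^+ (rk_matroid M - mrank M A).
Proof.
move=> AM; have groundA : ground (restriction M A) = A by apply/setIidPr.
rewrite /chain_tutte /chain_sum /rk_matroid groundA big_distrl /=.
apply: eq_bigr => S /andP[_ /allP SA].
rewrite -big_split /=; apply: eq_bigr => i _.
have SiA : tnth S i \subset A by apply: SA; apply: mem_tnth.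
rewrite mulrAC -exprD addnC addnBA ?subnK //.
  exact: mrank_mono.
exact: mrank_mono.
Qed.

Lemma mrank_nonloop M a :
  a \in ground M -> ~~ loop M a -> mrank M [set a] = 1%N.
Proof.
move=> aM; rewrite /loop aM /= -lt0n => r_gt0; apply/eqP.
by rewrite eqn_leq r_gt0 andbT -(cards1 a) mrank_le_card // sub1set.
Qed.

Lemma rk_deletion M a : a \in ground M -> ~~ coloop M a ->
  rk_matroid (deletion M a) = rk_matroid M.
Proof.
move=> aM; rewrite /coloop aM /= => ncol.
have aM1 : [set a] \subset ground M by rewrite sub1set.
have DM : ground M :\ a \subset ground M by apply: subD1set.
(* Submodularity gives [rk(M) <= 1 + rk(M\a)], and equality would make [a] a coloop. *)
have := mrank_submod aM1 DM; rewrite setD1K // => sub.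
have le1 : (mrank M [set a] <= 1)%N by rewrite -(cards1 a) mrank_le_card.
apply/eqP; rewrite eqn_leq (mrank_mono DM (subxx _)) /= -ltnS.
rewrite ltn_neqAle eq_sym ncol /= -add1n.
apply: leq_trans (leq_addr _ _) (leq_trans sub _).
by rewrite leq_add2r.
Qed.

(** Both terms of each exponent drop by one. Truncated subtraction respects this because [a |: A]
    has positive rank. *)
Lemma tutte_weight_contraction M a (aM : a \in ground M) i A :
  ~~ loop M a -> A \subset ground M :\ a ->
  tutte_weight M i (a |: A) = tutte_weight (contraction aM) i A.
Proof.
move=> nloop AE; have r1 := mrank_nonloop aM nloop.
have aA : a \notin A by apply: contra (subsetP AE a) _; rewrite setD11.
have rA_gt0 : (0 < mrank M (a |: A))%N.
  rewrite -r1; apply: mrank_mono; first exact: subsetUl.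
  by rewrite subUset sub1set aM (subset_trans AE (subD1set _ _)).
rewrite /tutte_weight /rk_matroid /= /contraction_rank r1 setD1K // cardsU1 aA.
case: (mrank M (a |: A)) rA_gt0 => // r _.
by rewrite !subn1 add1n subSS -subn1 -subnDA.
Qed.

Lemma chain_tutte_splitE k j M a (aM : a \in ground M) :
  (j <= k)%N -> ~~ loop M a -> ~~ coloop M a ->
  chain_tutte_split k j aM x y =
  split_chain_sum a (k - j) j (ground M :\ a) (tutte_weight M).
Proof.
move=> le_jk nloop ncol; rewrite /chain_tutte_split.
case: eqP => [->|_].
  rewrite subn0; apply: eq_bigr => S /andP[_ /allP SE].
  rewrite chain_sum0 mul1r; apply: eq_bigr => i _.
  by rewrite addn0 tutte_weight_contraction // SE ?mem_tnth.
(* For [j = k] no set contains [a], and only the total rank has to be compared between [M] and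
   [M\a]. *)
case: eqP => [->|/eqP neq_jk].
  rewrite subnn split_chain_sum0; apply: eq_bigr => S _.
  by apply: eq_bigr => i _; rewrite rk_deletion.
apply: eq_bigr => S /andP[_ /allP SE].
have size_gt0 : (0 < size S)%N by rewrite size_tuple subn_gt0 ltn_neqAle neq_jk.
(* Here [j < k], so the chain is nonempty and the two default values of [head] do not matter. *)
have -> : head (ground M :\ a) S = head set0 S by case: (val S) size_gt0.
have hE : head set0 S \subset ground M :\ a.
  by apply: SE; rewrite -nth0 mem_nth.
rewrite chain_sum_subset; last exact: subset_trans hE (subD1set _ _).
rewrite mulrAC; congr (_ * _ * _); apply: eq_bigr => i _.
by rewrite tutte_weight_contraction // SE ?mem_tnth.
Qed.

End Tutte.

Theorem theorem3p11 (R : comNzRingType) (T : finType) (M : matroid T)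
    (k : nat) (a : T) (x y : nat -> R)
    (k_gt0 : (0 < k)%N) (aM : a \in ground M)
    (a_not_loop : ~~ loop M a) (a_not_coloop : ~~ coloop M a) :
  chain_tutte k M x y =
  \sum_(j < k.+1) chain_tutte_split k j aM x y.
Proof.
rewrite -[LHS]/(chain_sum k (ground M) (tutte_weight x y M)).
rewrite -[in LHS](setD1K aM) chain_sum_setU1 ?setD11 //.
by apply: eq_bigr => j _; rewrite chain_tutte_splitE // -ltnS.
Qed.
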